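(* Let $F$ be a Dirac structure of a pre-symplectic algebroid $(E,\star,\rho,(\cdot,\cdot)_-)$. Then $(F,\star|_F,\rho|_F)$ is a left-symmetric algebroid.
   Context: All vector bundles are real, of finite rank, over a fixed smooth manifold $M$; bundle maps cover the identity of $M$. A pre-symplectic algebroid $(E,\star,\rho,(\cdot,\cdot)_-)$ is a vector bundle $E\to M$ equipped with a nondegenerate skew-symmetric ($C^\infty(M)$-)bilinear form $(\cdot,\cdot)_-$, an ($\mathbb R$-bilinear) multiplication $\star:\Gamma(E)\times\Gamma(E)\to\Gamma(E)$ and a bundle map $\rho:E\to TM$ such that for all $e_1,e_2,e_3\in\Gamma(E)$: (i) $(e_1,e_2,e_3)-(e_2,e_1,e_3)=\frac16 D\,T(e_1,e_2,e_3)$; (ii) $\rho(e_1)(e_2,e_3)_-=(e_1\star e_2-\frac12D(e_1,e_2)_-,\,e_3)_-+(e_2,[e_1,e_3]_E)_-$. Here $(e_1,e_2,e_3)=e_1\star(e_2\star e_3)-(e_1\star e_2)\star e_3$; $T(e_1,e_2,e_3)=(e_1\star e_2,e_3)_-+(e_1,e_2\star e_3)_--(e_2\star e_1,e_3)_--(e_2,e_1\star e_3)_-\in C^\infty(M)$; $D:C^\infty(M)\to\Gamma(E)$ is defined by $(Df,e)_-=\rho(e)(f)$; and $[e_1,e_2]_E=e_1\star e_2-e_2\star e_1$. A Dirac structure of $E$ is a subbundle $F\subset E$ that is maximally isotropic with respect to $(\cdot,\cdot)_-$ and integrable, i.e. $\Gamma(F)$ is closed under $\star$. A left-symmetric algebroid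 $(A,\cdot_A,a_A)$ is a vector bundle $A\to M$ with an $\mathbb R$-bilinear product $\cdot_A$ on $\Gamma(A)$ whose associator $x\cdot_A(y\cdot_Az)-(x\cdot_Ay)\cdot_Az$ is symmetric in $x,y$, and a bundle map $a_A:A\to TM$ with $x\cdot_A(fy)=f(x\cdot_Ay)+a_A(x)(f)y$ and $(fx)\cdot_Ay=f(x\cdot_Ay)$ for $x,y\in\Gamma(A)$, $f\in C^\infty(M)$. *)

(* Defs.v *)
From HB Require Import structures.
From mathcomp Require Import all_boot all_order all_algebra.
From mathcomp Require Import boolp classical_sets functions reals topology.
From mathcomp Require Import normedtype derive landau.

Set Implicit Arguments.
Unset Strict Implicit.
Unset Printing Implicit Defensive.

Import Order.TTheory GRing.Theory Num.Theory.
Import numFieldNormedType.Exports.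

Local Open Scope classical_set_scope.
Local Open Scope ring_scope.

Section Calculus.
Variable R : realType.

Definition partial n (i : 'I_n) (f : 'rV[R]_n -> R) (y : 'rV[R]_n) : R :=
  'D_(delta_mx 0 i) f y.

(* f is C^(k+1) on the open set A when it is (Frechet) differentiable at every
   point of A and all its first partial derivatives are C^k on A. *)
Fixpoint Ck n (k : nat) (A : set 'rV[R]_n) (f : 'rV[R]_n -> R) : Prop :=
  match k with
  | 0 => forall y, A y -> {for y, continuous f}
  | k'.+1 => (forall y, A y -> differentiable f y) /\
             forall i : 'I_n, Ck k' A (partial i f)
  end.

Definition Coo n (A : set 'rV[R]_n) (f : 'rV[R]_n -> R) : Prop :=
  forall k, Ck k A f.

Lemma near_eq_differentiable n (f g : 'rV[R]_n -> R) y :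
  (\near y, f y = g y) -> differentiable f y -> differentiable g y.
Proof.
move=> fg /diff_locallyP [cf ef].
have fgy : f y = g y by exact: nbhs_singleton fg.
have ed : 'd g y = 'd f y :> (_ -> _).
  apply: diff_unique; first exact: cf.
  rewrite -fgy.
  apply/eqaddoP => e e0.
  have /eqaddoP := ef; move=> /(_ e e0).
  have : \forall h \near (0 : 'rV[R]_n), f (h + y) = g (h + y).
    by move: fg; rewrite (near_shift 0) /= subr0; apply: filterS => z.
  by apply: filterS2 => h /= /[swap]; rewrite !fctE /= => ? <-.
apply/diff_locallyP; rewrite ed; split=> //; rewrite -fgy.
apply/eqaddoP => e e0.
have /eqaddoP := ef; move=> /(_ e e0).
have : \forall h \near (0 : 'rV[R]_n), f (h + y) = g (h + y).
  by move: fg; rewrite (near_shift 0) /= subr0; apply: filterS => z.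
by apply: filterS2 => h /= /[swap]; rewrite !fctE /= => ? <-.
Qed.

Lemma Ck_ext n k (A : set 'rV[R]_n) f g : open A ->
  (forall y, A y -> f y = g y) -> Ck k A f -> Ck k A g.
Proof.
move=> oA; elim: k f g => [|k IH] f g fg.
  move=> cf y Ay.
  have nA : nbhs y A by exact: open_nbhs_nbhs.
  have nfg : \forall z \near y, f z = g z by apply: filterS nA => z /fg.
  suff gf : g @ y --> f y by rewrite (fg _ Ay) in gf.
  apply: cvg_trans (cf y Ay); exact: (@near_eq_cvg _ _ (nbhs y) (nbhs_filter y) f g nfg).
move=> [df pf]; split=> [y Ay|i].
  apply: near_eq_differentiable (df y Ay).
  by apply: filterS (open_nbhs_nbhs (conj oA Ay)) => z /fg.
apply: IH (pf i) => y Ay; apply: near_eq_derive.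
by apply: filterS (open_nbhs_nbhs (conj oA Ay)) => z /fg.
Qed.

Lemma Ck_sub n k (A B : set 'rV[R]_n) f : A `<=` B -> Ck k B f -> Ck k A f.
Proof.
move=> AB; elim: k f => [|k IH] f /=; first by move=> cf y /AB/cf.
by move=> [df pf]; split=> [y /AB/df|i]; [|exact: IH].
Qed.

Lemma Ck_local n k (A : set 'rV[R]_n) f :
  (forall y, A y -> exists2 B, B y & Ck k B f) -> Ck k A f.
Proof.
elim: k f => [|k IH] f H /=; first by move=> y /H[B By]; exact.
split=> [y /H[B By] []|i]; first by move=> + _; exact.
by apply: IH => y /H[B By [_ pB]]; exists B => //; exact: pB.
Qed.

Lemma CkW n k (A : set 'rV[R]_n) f : Ck k.+1 A f -> Ck k A f.
Proof.
elim: k f => [|k IH] f; first by move=> [df _] y /df /differentiable_continuous.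
by move=> [df pf]; split=> // i; apply: IH.
Qed.

Lemma Ck_cst n k (A : set 'rV[R]_n) (c : R) : Ck k A (fun=> c).
Proof.
elim: k c => [|k IH] c; first by move=> y _; exact: cst_continuous.
split=> [y _|i]; first exact: differentiable_cst.
have -> : partial i (fun=> c) = fun=> 0.
  by apply: funext => y; rewrite /partial derive_cst.
exact: IH.
Qed.

Lemma CkD n k (A : set 'rV[R]_n) f g : open A -> Ck k A f -> Ck k A g ->
  Ck k A (fun y => f y + g y).
Proof.
move=> oA; elim: k f g => [|k IH] f g; first by move=> cf cg y Ay; apply: continuousD; auto.
move=> [df pf] [dg pg]; split=> [y Ay|i].
  by apply: (@differentiableD _ _ _ f g); auto.
apply: (Ck_ext oA) (IH _ _ (pf i) (pg i)) => y Ay.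
by rewrite /partial -deriveD //; apply: diff_derivable; auto.
Qed.

Lemma CkM n k (A : set 'rV[R]_n) f g : open A -> Ck k A f -> Ck k A g ->
  Ck k A (fun y => f y * g y).
Proof.
move=> oA; elim: k f g => [|k IH] f g; first by move=> cf cg y Ay; apply: continuousM; auto.
move=> Sf Sg; move: (Sf) (Sg) => [df pf] [dg pg]; split=> [y Ay|i].
  by apply: (@differentiableM _ _ f g); auto.
apply: (Ck_ext oA) (CkD oA (IH _ _ (CkW Sf) (pg i)) (IH _ _ (CkW Sg) (pf i))) => y Ay.
by rewrite /partial -(@deriveM _ _ f g) //; apply: diff_derivable; auto.
Qed.

Lemma Ck_sum n k (A : set 'rV[R]_n) m (f : 'I_m -> 'rV[R]_n -> R) : open A ->
  (forall j, Ck k A (f j)) -> Ck k A (fun y => \sum_j f j y).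
Proof.
move=> oA cf.
have -> : (fun y => \sum_j f j y) = (fun y => \sum_(j <- enum 'I_m) f j y).
  by apply: funext => y; rewrite big_enum.
elim: (enum _) => [|j s IH].
  apply: (Ck_ext oA) (Ck_cst k A 0) => y _; by rewrite big_nil.
by apply: (Ck_ext oA) (CkD oA (cf j) IH) => y _; rewrite big_cons.
Qed.

Lemma differentiable_rV n m (g : 'rV[R]_n -> 'rV[R]_m) y :
  (forall j, differentiable (fun z => g z 0 j) y) -> differentiable g y.
Proof.
move=> dg.
have -> : g = \sum_(j < m) (fun z => g z 0 j *: delta_mx 0 j).
  apply: funext => z; rewrite fct_sumE; exact: row_sum_delta.
apply: differentiable_sum => j; apply: differentiableZl; exact: dg.
Qed.

Lemma derive_rV n m (g : 'rV[R]_n -> 'rV[R]_m) y v :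
  differentiable g y -> forall j, ('D_v g y) 0 j = 'D_v (fun z => g z 0 j) y.
Proof.
move=> dg j; rewrite derive_mx ?mxE //; exact: diff_derivable.
Qed.

Lemma derive_delta n (f : 'rV[R]_n -> R) y v : differentiable f y ->
  'D_v f y = \sum_j v 0 j * partial j f y.
Proof.
move=> df; rewrite deriveE // {1}[v]row_sum_delta linear_sum; apply: eq_bigr => j _.
by rewrite linearZ /partial deriveE.
Qed.

Lemma derive_comp_rV n m (g : 'rV[R]_n -> 'rV[R]_m) (f : 'rV[R]_m -> R) y v :
  differentiable g y -> differentiable f (g y) ->
  'D_v (f \o g) y = \sum_j 'D_v (fun z => g z 0 j) y * partial j f (g y).
Proof.
move=> dg df; rewrite deriveE; last exact: differentiable_comp.
rewrite diff_comp //= -!deriveE // derive_delta //.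
by apply: eq_bigr => j _; rewrite derive_rV.
Qed.

Lemma Ck_comp n m k (A : set 'rV[R]_n) (B : set 'rV[R]_m)
    (g : 'rV[R]_n -> 'rV[R]_m) (f : 'rV[R]_m -> R) :
  open A -> (forall y, A y -> B (g y)) ->
  (forall j, Ck k A (fun y => g y 0 j)) -> Ck k B f -> Ck k A (f \o g).
Proof.
move=> oA AB; elim: k f => [|k IH] f cg.
  move=> cf y Ay.
  have cgy : {for y, continuous g}.
    move=> C [P /= nP PC].
    have H (j : 'I_m) : nbhs y [set z | P 0 j (g z 0 j)].
      exact: (cg j y Ay (P 0 j) (nP 0 j)).
    have := @filter_forall _ _ _ (nbhs y) (nbhs_filter y) H.
    by apply: filterS => z Pz; apply: PC => i' j; rewrite (ord1 i'); exact: Pz.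
  by apply: continuous_comp => //; apply: cf; apply: AB.
move=> [df pf].
have dg y : A y -> differentiable g y.
  by move=> Ay; apply: differentiable_rV => j; case: (cg j) => + _; exact.
split=> [y Ay|i]; first by apply: differentiable_comp; auto.

apply: (Ck_ext oA (f := fun y => \sum_j partial i (fun z => g z 0 j) y * partial j f (g y))).
  by move=> y Ay; rewrite /partial derive_comp_rV; auto.
apply: Ck_sum => // j; apply: CkM => //; first by case: (cg j) => _; exact.
by apply: IH => // [j'|]; [exact: CkW|exact: pf].
Qed.

Lemma Ck_coord n k (A : set 'rV[R]_n) j : Ck k A (fun y => y 0 j).
Proof.
have dc y : differentiable (fun z : 'rV[R]_n => z 0 j) y by exact: differentiable_coord.
case: k => [|k]; first by move=> y _; exact: differentiable_continuous.
split=> // i.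
have -> : partial i (fun y : 'rV[R]_n => y 0 j) = fun=> (j == i)%:R.
  apply: funext => y; rewrite /partial -derive_rV // derive_id mxE eqxx /= //.
exact: Ck_cst.
Qed.

End Calculus.

Section Manifold.
Variables (R : realType) (n : nat).

(* A Hausdorff second countable space with a smooth atlas; [chart_of a] is the
   inverse of [chart_to a], and both are only meaningful on the open sets
   [chart_dom a] and [chart_cod a].  [chart_at] selects a chart around each
   point; it only serves to represent tangent vectors (see [tangent_bundle]). *)
Record smooth_manifold := SmoothManifold {
  mf_carrier :> topologicalType;
  mf_hausdorff : hausdorff_space mf_carrier;
  mf_second_countable : @second_countable mf_carrier;
  chart : Type;
  chart_dom : chart -> set mf_carrier;
  chart_cod : chart -> set 'rV[R]_n;
  chart_to : chart -> mf_carrier -> 'rV[R]_n;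
  chart_of : chart -> 'rV[R]_n -> mf_carrier;
  chart_dom_open : forall a, open (chart_dom a);
  chart_cod_open : forall a, open (chart_cod a);
  chart_to_cod : forall a x, chart_dom a x -> chart_cod a (chart_to a x);
  chart_of_dom : forall a y, chart_cod a y -> chart_dom a (chart_of a y);
  chart_toK : forall a x, chart_dom a x -> chart_of a (chart_to a x) = x;
  chart_ofK : forall a y, chart_cod a y -> chart_to a (chart_of a y) = y;
  chart_to_continuous :
    forall a x, chart_dom a x -> {for x, continuous (chart_to a)};
  chart_of_continuous :
    forall a y, chart_cod a y -> {for y, continuous (chart_of a)};
  chart_at : mf_carrier -> chart;
  chart_at_dom : forall x, chart_dom (chart_at x) x;
  chart_transition : forall a b j,
    Coo [set y | chart_cod a y /\ chart_dom b (chart_of a y)]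
        (fun y => chart_to b (chart_of a y) 0 j)
}.

End Manifold.

Section SmoothFunctions.
Variables (R : realType) (n : nat) (M : smooth_manifold R n).
Implicit Types (f g : M -> R) (U V W : set M).

Definition chart_image (a : chart M) W : set 'rV[R]_n :=
  [set y | chart_cod a y /\ W (chart_of a y)].

Definition smooth_on W f : Prop :=
  forall a, Coo (chart_image a W) (f \o chart_of a).

Lemma chart_image_open a W : open W -> open (chart_image a W).
Proof.
move=> oW; rewrite openE => y [ay Wy].
have n1 : nbhs y (chart_cod a) by apply: open_nbhs_nbhs; split; [exact: chart_cod_open|].
have n2 : nbhs y (chart_of a @^-1` W).
  by apply: (chart_of_continuous ay); exact: open_nbhs_nbhs.
by apply: filterS2 n1 n2 => z.
Qed.

Lemma smooth_on_chart W f :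
  (forall p, W p -> exists a V, [/\ open V, V p, chart_dom a p &
     Coo (chart_image a V) (f \o chart_of a)]) -> smooth_on W f.
Proof.
move=> H b k; apply: Ck_local => y [by_ Wy].
have [a [V [oV Vp ap cf]]] := H _ Wy.
have oB : open (chart_image b (V `&` chart_dom a)).
  by apply/chart_image_open/openI => //; exact: chart_dom_open.
exists (chart_image b (V `&` chart_dom a)); first by [].
apply: (Ck_ext oB (f := (f \o chart_of a) \o (chart_to a \o chart_of b))).
  by move=> z [bz [Vz az]] /=; rewrite chart_toK.
apply: (Ck_comp oB _ _ (cf k)).
- move=> z [bz [Vz az]] /=; split; first exact: chart_to_cod.
  by rewrite /= chart_toK.
- move=> j; apply: (Ck_sub _ (chart_transition b a j k)).
  by move=> z [bz [Vz az]].
Qed.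

Lemma smooth_on_sub V W f : V `<=` W -> smooth_on W f -> smooth_on V f.
Proof.
by move=> VW sf a k; apply: (Ck_sub _ (sf a k)) => y [ay Vy]; split=> //; exact: VW.
Qed.

Lemma smooth_on_local W f :
  (forall p, W p -> exists V, [/\ open V, V p & smooth_on V f]) ->
  smooth_on W f.
Proof.
move=> H; apply: smooth_on_chart => p /H[V [oV Vp sf]].
by exists (chart_at p), V; split=> //; exact: chart_at_dom.
Qed.

Lemma smooth_on_ext W f g : open W -> (forall x, W x -> f x = g x) ->
  smooth_on W f -> smooth_on W g.
Proof.
move=> oW fg sf a k. apply: (Ck_ext (chart_image_open oW) _ (sf a k)).
by move=> y [_ /fg].
Qed.

Lemma smooth_on_cst W c : smooth_on W (fun=> c).
Proof. by move=> a k; exact: Ck_cst. Qed.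

Lemma smooth_onD W f g : open W -> smooth_on W f -> smooth_on W g ->
  smooth_on W (fun x => f x + g x).
Proof. by move=> oW sf sg a k; apply: CkD; [exact: chart_image_open|exact: sf|exact: sg]. Qed.

Lemma smooth_onM W f g : open W -> smooth_on W f -> smooth_on W g ->
  smooth_on W (fun x => f x * g x).
Proof. by move=> oW sf sg a k; apply: CkM; [exact: chart_image_open|exact: sf|exact: sg]. Qed.

Lemma smooth_on_sum W m (f : 'I_m -> M -> R) : open W ->
  (forall j, smooth_on W (f j)) -> smooth_on W (fun x => \sum_j f j x).
Proof.
move=> oW sf a k; apply: (Ck_sum (f := fun j => f j \o chart_of a)).
  exact: chart_image_open.
by move=> j; exact: sf.
Qed.

Lemma smooth_on_partial W f a i : open W -> smooth_on W f ->
  smooth_on (W `&` chart_dom a)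
    (fun x => partial i (f \o chart_of a) (chart_to a x)).
Proof.
move=> oW sf; have oWa : open (W `&` chart_dom a) by apply: openI => //; exact: chart_dom_open.
apply: smooth_on_chart => p [Wp ap]; exists a, (W `&` chart_dom a); split=> // k.
apply: (Ck_ext (chart_image_open oWa) (f := partial i (f \o chart_of a))).
  by move=> y [ay _] /=; rewrite chart_ofK.
have [_ H] := sf a k.+1; apply: (Ck_sub _ (H i)).
by move=> y [ay [Wy _]].
Qed.

Lemma smooth_on_coord a j : smooth_on (chart_dom a) (fun x => chart_to a x 0 j).
Proof. by move=> b; exact: chart_transition. Qed.

Lemma smooth_on_differentiable W f a p : smooth_on W f -> W p -> chart_dom a p ->
  differentiable (f \o chart_of a) (chart_to a p).
Proof.
move=> sf Wp ap; have [H _] := sf a 1%N; apply: H; split; first exact: chart_to_cod.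
by rewrite /= chart_toK.
Qed.

Lemma partial_chart W f a b p v : open W -> smooth_on W f ->
  W p -> chart_dom a p -> chart_dom b p ->
  'D_v (f \o chart_of b) (chart_to b p) =
  \sum_j 'D_v (fun y => chart_to a (chart_of b y) 0 j) (chart_to b p) *
         partial j (f \o chart_of a) (chart_to a p).
Proof.
move=> oW sf Wp ap bp.
have dg : differentiable (chart_to a \o chart_of b) (chart_to b p).
  by apply: differentiable_rV => j; exact: (smooth_on_differentiable (@smooth_on_coord a j) ap bp).
have E : (chart_to a \o chart_of b) (chart_to b p) = chart_to a p by rewrite /= chart_toK.
have df : differentiable (f \o chart_of a) ((chart_to a \o chart_of b) (chart_to b p)).
  by rewrite E; exact: (smooth_on_differentiable sf Wp ap).
have := derive_comp_rV v dg df; rewrite E => <-.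
apply: near_eq_derive.
have : nbhs (chart_to b p) (chart_image b (chart_dom a)).
  apply: open_nbhs_nbhs; split; first exact/chart_image_open/chart_dom_open.
  by split; [exact: chart_to_cod|rewrite /= chart_toK].
by apply: filterS => y [_ ay] /=; rewrite chart_toK.
Qed.

Record smooth_fun := SmoothFun {
  sf_val :> M -> R;
  sf_smooth : smooth_on setT sf_val
}.

Lemma smooth_funP (f g : smooth_fun) : (forall x, f x = g x) -> f = g.
Proof.
case: f g => [f sf] [g sg] /= /funext fg; rewrite fg in sf *.
by congr SmoothFun; exact: Prop_irrelevance.
Qed.

HB.instance Definition _ := gen_eqMixin smooth_fun.
HB.instance Definition _ := gen_choiceMixin smooth_fun.

Definition sf_cst (c : R) : smooth_fun := SmoothFun (smooth_on_cst setT c).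
Definition sf_add (f g : smooth_fun) : smooth_fun :=
  SmoothFun (smooth_onD openT (sf_smooth f) (sf_smooth g)).
Definition sf_mul (f g : smooth_fun) : smooth_fun :=
  SmoothFun (smooth_onM openT (sf_smooth f) (sf_smooth g)).
Definition sf_opp (f : smooth_fun) : smooth_fun := sf_mul (sf_cst (-1)) f.

Lemma sf_addA : associative sf_add.
Proof. by move=> f g h; apply: smooth_funP => x /=; rewrite addrA. Qed.
Lemma sf_addC : commutative sf_add.
Proof. by move=> f g; apply: smooth_funP => x /=; rewrite addrC. Qed.
Lemma sf_add0 : left_id (sf_cst 0) sf_add.
Proof. by move=> f; apply: smooth_funP => x /=; rewrite add0r. Qed.
Lemma sf_addN : left_inverse (sf_cst 0) sf_opp sf_add.
Proof. by move=> f; apply: smooth_funP => x /=; rewrite mulN1r addNr. Qed.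

HB.instance Definition _ :=
  GRing.isZmodule.Build smooth_fun sf_addA sf_addC sf_add0 sf_addN.

Lemma sf_mulA : associative sf_mul.
Proof. by move=> f g h; apply: smooth_funP => x /=; rewrite mulrA. Qed.
Lemma sf_mulC : commutative sf_mul.
Proof. by move=> f g; apply: smooth_funP => x /=; rewrite mulrC. Qed.
Lemma sf_mul1 : left_id (sf_cst 1) sf_mul.
Proof. by move=> f; apply: smooth_funP => x /=; rewrite mul1r. Qed.
Lemma sf_mulDl : left_distributive sf_mul sf_add.
Proof. by move=> f g h; apply: smooth_funP => x /=; rewrite mulrDl. Qed.

HB.instance Definition _ :=
  GRing.Zmodule_isComPzRing.Build smooth_fun sf_mulA sf_mulC sf_mul1 sf_mulDl.

End SmoothFunctions.

Section VectorBundles.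
Variables (R : realType) (n : nat) (M : smooth_manifold R n).

(* A real vector bundle of rank [vb_rank], given by its fibres and a vector
   bundle atlas: each local trivialization is recorded as a frame over an open
   set, and the transition matrices between frames are smooth. *)
Record vector_bundle := VectorBundle {
  vb_fiber :> M -> vectType R;
  vb_rank : nat;
  triv : Type;
  triv_dom : triv -> set M;
  frame : triv -> forall x, vb_rank.-tuple (vb_fiber x);
  triv_dom_open : forall t, open (triv_dom t);
  triv_cover : forall x, exists t, triv_dom t x;
  frame_basis : forall t x, triv_dom t x -> basis_of fullv (frame t x);
  frame_transition : forall t u (i j : 'I_vb_rank),
    smooth_on (triv_dom t `&` triv_dom u)
      (fun x => coord (frame u x) j (frame t x)`_i)
}.

End VectorBundles.

Section LinearAlgebra.
Variables (K : fieldType) (vT : vectType K).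

Lemma coord_change m p (e : m.-tuple vT) (f : p.-tuple vT) j v :
  basis_of fullv e -> coord f j v = \sum_i coord e i v * coord f j e`_i.
Proof.
move=> be; rewrite {1}(coord_basis be (memvf v)) linear_sum.
by apply: eq_bigr => i _; rewrite linearZ.
Qed.

Lemma rows_basis m (A B : 'M[K]_m) : A *m B = 1%:M -> B *m A = 1%:M ->
  basis_of fullv [tuple row i A | i < m] /\
  forall j v, coord [tuple row i A | i < m] j v = (v *m B) 0 j.
Proof.
move=> AB BA.
have rE (i : 'I_m) : [tuple row i A | i < m]`_i = row i A.
  by rewrite (nth_map i) -?enumT ?size_enum_ord // nth_ord_enum.
have vE (v : 'rV_m) : v = \sum_i (v *m B) 0 i *: [tuple row i A | i < m]`_i.
  rewrite -{1}[v]mulmx1 -BA mulmxA mulmx_sum_row.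
  by apply: eq_bigr => i _; rewrite rE.
have bA : basis_of fullv [tuple row i A | i < m].
  have dimE : dim 'rV[K]_m = m by rewrite dim_matrix; exact: mul1n.
  rewrite basisEdim size_tuple dimvf dimE leqnn andbT.
  apply/subvP => v _; rewrite [v]vE; apply: memv_suml => i _.
  by apply/memvZ/memv_span; rewrite mem_nth ?size_tuple.
by split=> // j v; rewrite {1}[v]vE coord_sum_free // (basis_free bA).
Qed.

Variables (m r : nat) (rm : (r <= m)%N) (F : {vspace vT}) (e : m.-tuple vT).
Hypotheses (be : basis_of fullv e) (eF : F = <<take r e>>%VS).

Definition sub_frame : r.-tuple (subvs_of F) :=
  [tuple vsproj F e`_i | i < r].

Lemma sub_frameE (i : 'I_r) : vsval sub_frame`_i = e`_i.
Proof.
rewrite (nth_map i) -?enumT ?size_enum_ord // nth_ord_enum vsprojK //.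
rewrite eF; apply: memv_span; rewrite -(nth_take _ (ltn_ord i)) mem_nth //.
by rewrite size_take_min size_tuple (minn_idPl rm).
Qed.

Lemma coord_vsval_sum (c : 'I_r -> K) j :
  coord e (widen_ord rm j) (vsval (\sum_i c i *: sub_frame`_i)) = c j.
Proof.
rewrite !linear_sum (bigD1 j) //= !linearZ /= sub_frameE.
rewrite (coord_free (widen_ord rm j)) ?(basis_free be) // eqxx mulr1.
rewrite big1 ?addr0 // => i ij; rewrite !linearZ /= sub_frameE.
rewrite (coord_free (widen_ord rm i)) ?(basis_free be) //.
by rewrite -val_eqE /= (inj_eq val_inj) (negPf ij) mulr0.
Qed.

Lemma sub_frame_basis : basis_of fullv sub_frame.
Proof.
rewrite basisEfree subvf size_tuple; apply/andP; split.
  apply/(@freeP _ _ r sub_frame) => k k0 i; rewrite -(coord_vsval_sum k i) k0.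
  by rewrite [vsval _](_ : _ = 0) ?linear0.
rewrite dimvf /dim /= eF (leq_trans (dim_span _)) //.
by rewrite size_take_min geq_minl.
Qed.

Lemma coord_sub_frame j u :
  coord sub_frame j u = coord e (widen_ord rm j) (vsval u).
Proof. by rewrite {2}(coord_basis sub_frame_basis (memvf u)) coord_vsval_sum. Qed.

End LinearAlgebra.

Section Sections.
Variables (R : realType) (n : nat) (M : smooth_manifold R n).
Implicit Types (E F : vector_bundle M) (U V W : set M).

Definition smooth_section_on E W (s : forall x, E x) : Prop :=
  forall (t : triv E) j,
    smooth_on (W `&` triv_dom t) (fun x => coord (frame t x) j (s x)).

(* [e] is a local trivialization over [U] belonging to the maximal atlas. *)
Definition compatible_frame E U (e : forall x, (vb_rank E).-tuple (E x)) : Prop :=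
  [/\ open U, forall x, U x -> basis_of fullv (e x),
      forall i : 'I_(vb_rank E), smooth_section_on U (fun x => (e x)`_i) &
      forall t (i j : 'I_(vb_rank E)),
        smooth_on (U `&` triv_dom t) (fun x => coord (e x) j (frame t x)`_i)].

Lemma frame_compatible E (t : triv E) : compatible_frame (triv_dom t) (frame t).
Proof.
split; [exact: triv_dom_open|exact: frame_basis| |].
- by move=> i u j; exact: frame_transition.
- by move=> u i j; rewrite setIC; exact: frame_transition.
Qed.

Lemma smooth_section_on_sub E V W (s : forall x, E x) :
  V `<=` W -> smooth_section_on W s -> smooth_section_on V s.
Proof. by move=> VW ss t j; apply: smooth_on_sub (ss t j) => x [/VW]. Qed.

Lemma smooth_coord_frame E U e W (s : forall x, E x) j :
  open W -> compatible_frame U e -> smooth_section_on W s ->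
  smooth_on (W `&` U) (fun x => coord (e x) j (s x)).
Proof.
move=> oW [oU be se te] ss; apply: smooth_on_local => p [Wp Up].
have [t tp] := triv_cover E p.
pose V := W `&` U `&` triv_dom t.
have oV : open V by apply: openI; [exact: openI|exact: triv_dom_open].
exists V; split=> //.
apply: (smooth_on_ext oV (f := fun x => \sum_i coord (frame t x) i (s x) *
                                      coord (e x) j (frame t x)`_i)).
  by move=> x [_ tx]; rewrite -coord_change //; exact: frame_basis.
apply: smooth_on_sum => // i; apply: smooth_onM => //.
- by apply: smooth_on_sub (ss t i) => x [[]].
- by apply: smooth_on_sub (te t i j) => x [[]].
Qed.

Lemma smooth_section_frame E U e W (s : forall x, E x) :
  open W -> compatible_frame U e -> W `<=` U ->
  (forall j, smooth_on W (fun x => coord (e x) j (s x))) ->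
  smooth_section_on W s.
Proof.
move=> oW [oU be se te] WU ss t j.
have oV : open (W `&` triv_dom t) by apply: openI => //; exact: triv_dom_open.
apply: (smooth_on_ext oV (f := fun x => \sum_i coord (e x) i (s x) *
                                      coord (frame t x) j (e x)`_i)).
  by move=> x [/WU Ux tx]; rewrite -coord_change //; exact: be.
apply: smooth_on_sum => // i; apply: smooth_onM => //.
- by apply: smooth_on_sub (ss i) => x [].
- by apply: smooth_on_sub (se i t j) => x [/WU].
Qed.

Lemma smooth_section_local E W (s : forall x, E x) :
  (forall p, W p -> exists V, [/\ open V, V p & smooth_section_on V s]) ->
  smooth_section_on W s.
Proof.
move=> H t j; apply: smooth_on_local => p [/H[V [oV Vp sV]] tp].
exists (V `&` triv_dom t); split=> //; first by apply: openI => //; exact: triv_dom_open.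
Qed.

Record smooth_section E := SmoothSection {
  sec_val :> forall x, E x;
  sec_smooth : smooth_section_on setT sec_val
}.

Lemma smooth_sectionP E (s t : smooth_section E) : (forall x, s x = t x) -> s = t.
Proof.
case: s t => [s ss] [t st] /= est.
have es : s = t by exact: functional_extensionality_dep.
rewrite es in ss *.
by congr SmoothSection; exact: Prop_irrelevance.
Qed.

HB.instance Definition _ E := gen_eqMixin (smooth_section E).
HB.instance Definition _ E := gen_choiceMixin (smooth_section E).

Lemma sec_add_smooth E (s t : smooth_section E) :
  smooth_section_on setT (fun x => s x + t x).
Proof.
move=> u j; have oW : open (setT `&` triv_dom u).
  by apply: openI; [exact: openT|exact: triv_dom_open].
apply: (smooth_on_ext oW _ (smooth_onD oW (sec_smooth s u j) (sec_smooth t u j))).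
by move=> x _; rewrite linearD.
Qed.

Lemma sec_scale_smooth E (f : smooth_fun M) (s : smooth_section E) :
  smooth_section_on setT (fun x => f x *: s x).
Proof.
move=> u j; have oW : open (setT `&` triv_dom u).
  by apply: openI; [exact: openT|exact: triv_dom_open].
have sf : smooth_on (setT `&` triv_dom u) f by apply: smooth_on_sub (sf_smooth f).
apply: (smooth_on_ext oW _ (smooth_onM oW sf (sec_smooth s u j))).
by move=> x _; rewrite linearZ.
Qed.

Lemma sec_zero_smooth E : smooth_section_on setT (fun x => 0 : E x).
Proof.
move=> u j; have -> : (fun x => coord (frame u x) j (0 : E x)) = fun=> 0.
  by apply: funext => x; rewrite linear0.
exact: smooth_on_cst.
Qed.

Definition sec_zero E : smooth_section E := SmoothSection (@sec_zero_smooth E).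
Definition sec_add E (s t : smooth_section E) := SmoothSection (sec_add_smooth s t).
Definition sec_scale E f (s : smooth_section E) := SmoothSection (sec_scale_smooth f s).
Definition sec_opp E (s : smooth_section E) := sec_scale (-1) s.

Lemma sec_addA E : associative (@sec_add E).
Proof. by move=> s t u; apply: smooth_sectionP => x /=; rewrite addrA. Qed.
Lemma sec_addC E : commutative (@sec_add E).
Proof. by move=> s t; apply: smooth_sectionP => x /=; rewrite addrC. Qed.
Lemma sec_add0 E : left_id (sec_zero E) (@sec_add E).
Proof. by move=> s; apply: smooth_sectionP => x /=; rewrite add0r. Qed.
Lemma sec_addN E : left_inverse (sec_zero E) (@sec_opp E) (@sec_add E).
Proof.
move=> s; apply: smooth_sectionP => x /=.
by rewrite -[X in _ + X]scale1r -scalerDl mulN1r addNr scale0r.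
Qed.

HB.instance Definition _ E := GRing.isZmodule.Build (smooth_section E)
  (@sec_addA E) (@sec_addC E) (@sec_add0 E) (@sec_addN E).

Lemma sec_scaleA E f g (s : smooth_section E) :
  sec_scale f (sec_scale g s) = sec_scale (f * g) s.
Proof. by apply: smooth_sectionP => x /=; rewrite scalerA. Qed.
Lemma sec_scale1 E : left_id 1 (@sec_scale E).
Proof. by move=> s; apply: smooth_sectionP => x /=; rewrite scale1r. Qed.
Lemma sec_scaleDr E : right_distributive (@sec_scale E) +%R.
Proof. by move=> f s t; apply: smooth_sectionP => x /=; rewrite scalerDr. Qed.
Lemma sec_scaleDl E (s : smooth_section E) :
  {morph (@sec_scale E)^~ s : f g / f + g}.
Proof. by move=> f g; apply: smooth_sectionP => x /=; rewrite scalerDl. Qed.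

HB.instance Definition _ E := GRing.Zmodule_isLmodule.Build (smooth_fun M)
  (smooth_section E) (@sec_scaleA E) (@sec_scale1 E) (@sec_scaleDr E) (@sec_scaleDl E).

(* Bundle maps over the identity of [M]. *)
Record bundle_map E F := BundleMap {
  bm_fiber :> forall x, 'Hom(E x, F x);
  bm_smooth : forall (t : triv E) (i : 'I_(vb_rank E)),
    smooth_section_on (triv_dom t) (fun x => bm_fiber x (frame t x)`_i)
}.

Lemma bundle_map_section_on E F (h : bundle_map E F) W (s : forall x, E x) :
  open W -> smooth_section_on W s -> smooth_section_on W (fun x => h x (s x)).
Proof.
move=> oW ss u j; apply: smooth_on_local => p [Wp up].
have [t tp] := triv_cover E p.
pose V := W `&` triv_dom u `&` triv_dom t.
have oV : open V by do ![exact: triv_dom_open|apply: openI|].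
exists V; split=> //.
apply: (smooth_on_ext oV (f := fun x => \sum_i coord (frame t x) i (s x) *
                                      coord (frame u x) j (h x (frame t x)`_i))).
  move=> x [_ tx]; rewrite {2}(coord_basis (frame_basis tx) (memvf (s x))) !linear_sum.
  by apply: eq_bigr => i _; rewrite !linearZ.
apply: smooth_on_sum => // i; apply: smooth_onM => //.
- by apply: smooth_on_sub (ss t i) => x [[]].
- by apply: smooth_on_sub (@bm_smooth _ _ h t i u j) => x [[]].
Qed.

Definition bm_section E F (h : bundle_map E F) (s : smooth_section E) :
    smooth_section F :=
  SmoothSection (bundle_map_section_on h openT (sec_smooth s)).

Lemma bm_comp_smooth E F G (h : bundle_map F G) (k : bundle_map E F) (t : triv E)
    (i : 'I_(vb_rank E)) :
  smooth_section_on (triv_dom t) (fun x => (h x \o k x)%VF (frame t x)`_i).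
Proof.
have := bundle_map_section_on h (triv_dom_open t) (@bm_smooth _ _ k t i).
by congr smooth_section_on; apply: functional_extensionality_dep => x; rewrite comp_lfunE.
Qed.

Definition bm_comp E F G (h : bundle_map F G) (k : bundle_map E F) : bundle_map E G :=
  BundleMap (bm_comp_smooth h k).

End Sections.

Section TangentBundle.
Variables (R : realType) (n : nat) (M : smooth_manifold R n).

Definition jac (a b : chart M) (x : M) : 'M[R]_n :=
  \matrix_(i, j)
    partial i (fun y => chart_to b (chart_of a y) 0 j) (chart_to a x).

Lemma jac_comp a b c x : chart_dom a x -> chart_dom b x -> chart_dom c x ->
  jac a b x *m jac b c x = jac a c x.
Proof.
move=> ax bx cx; apply/matrixP => i j; rewrite !mxE.
rewrite [RHS](partial_chart _ (chart_dom_open c) (@smooth_on_coord _ _ M c j) cx bx ax).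
by apply: eq_bigr => k _; rewrite !mxE.
Qed.

Lemma jac_id a x : chart_dom a x -> jac a a x = 1%:M.
Proof.
move=> ax; apply/matrixP => i j; rewrite !mxE.
have -> : (i == j)%:R = 'D_(delta_mx 0 i) (fun y : 'rV[R]_n => y 0 j) (chart_to a x).
  by rewrite -derive_rV // derive_id mxE eqxx eq_sym.
apply: near_eq_derive.
have : nbhs (chart_to a x) (chart_cod a).
  by apply: open_nbhs_nbhs; split; [exact: chart_cod_open|exact: chart_to_cod].
by apply: filterS => y ay; rewrite chart_ofK.
Qed.

Lemma smooth_on_jac a b i j :
  smooth_on (chart_dom a `&` chart_dom b) (fun x => jac a b x i j).
Proof.
have := @smooth_on_partial _ _ M _ _ a i (chart_dom_open b) (@smooth_on_coord _ _ M b j).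
rewrite setIC; congr smooth_on; apply: funext => x; by rewrite mxE.
Qed.

(* The tangent space at [x] is modelled on R^n through the chart [chart_at x]:
   [v] stands for the tangent vector with components [v] in that chart.  The
   frame attached to a chart [a] is made of the coordinate fields of [a]. *)
Definition coordinate_frame (a : chart M) (x : M) : n.-tuple 'rV[R]_n :=
  [tuple row i (jac a (chart_at x) x) | i < n].

Lemma coordinate_frameE a x (i : 'I_n) :
  (coordinate_frame a x)`_i = row i (jac a (chart_at x) x).
Proof. by rewrite (nth_map i) -?enumT ?size_enum_ord // nth_ord_enum. Qed.

Lemma coordinate_frame_spec a x : chart_dom a x ->
  basis_of fullv (coordinate_frame a x) /\
  forall j v, coord (coordinate_frame a x) j v = (v *m jac (chart_at x) a x) 0 j.
Proof.
move=> ax; have cx := chart_at_dom x.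
by apply: rows_basis; rewrite jac_comp // jac_id.
Qed.

Lemma coordinate_frame_basis a x :
  chart_dom a x -> basis_of fullv (coordinate_frame a x).
Proof. by case/coordinate_frame_spec. Qed.

Lemma coordinate_frame_transition a b (i j : 'I_n) :
  smooth_on (chart_dom a `&` chart_dom b)
    (fun x => coord (coordinate_frame b x) j (coordinate_frame a x)`_i).
Proof.
have oW : open (chart_dom a `&` chart_dom b) by apply: openI; exact: chart_dom_open.
apply: (smooth_on_ext oW _ (@smooth_on_jac a b i j)) => x [ax bx].
have [_ ->] := coordinate_frame_spec bx.
have cx := chart_at_dom x.
by rewrite coordinate_frameE -row_mul jac_comp // [RHS]mxE.
Qed.

Definition tangent_bundle : vector_bundle M := {|
  vb_fiber := fun=> 'rV[R]_n;
  triv_dom_open := @chart_dom_open _ _ M;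
  triv_cover := fun x => ex_intro _ (chart_at x) (chart_at_dom x);
  frame_basis := coordinate_frame_basis;
  frame_transition := coordinate_frame_transition
|}.

Definition tangent_deriv (x : M) (v : tangent_bundle x) (f : M -> R) : R :=
  'D_v (f \o chart_of (chart_at x)) (chart_to (chart_at x) x).

Lemma tangent_derivE a W x (v : tangent_bundle x) f :
  open W -> smooth_on W f -> W x -> chart_dom a x ->
  tangent_deriv v f = \sum_i coord (coordinate_frame a x) i v *
                       partial i (f \o chart_of a) (chart_to a x).
Proof.
move=> oW sf Wx ax; have cx := chart_at_dom x.
have df := smooth_on_differentiable sf Wx cx.
rewrite /tangent_deriv derive_delta //.
rewrite {1}(coord_basis (coordinate_frame_basis ax) (memvf v)).
under [RHS]eq_bigr => i _.
  rewrite [X in _ * X](partial_chart _ oW sf Wx cx ax) mulr_sumr.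
  over.
rewrite exchange_big; apply: eq_bigr => j _; rewrite summxE mulr_suml.
by apply: eq_bigr => i _; rewrite mxE coordinate_frameE !mxE mulrA.
Qed.

Lemma vector_field_smooth (X : smooth_section tangent_bundle) (f : smooth_fun M) :
  smooth_on setT (fun x => tangent_deriv (X x) f).
Proof.
apply: smooth_on_local => p _; pose a := chart_at p.
have oV : open (setT `&` chart_dom a) by apply: openI; [exact: openT|exact: chart_dom_open].
exists (setT `&` chart_dom a); split=> //; first by split=> //; exact: chart_at_dom.
apply: (smooth_on_ext oV (f := fun x => \sum_i coord (coordinate_frame a x) i (X x) *
                       partial i (f \o chart_of a) (chart_to a x))).
  by move=> x [_ ax]; rewrite -(tangent_derivE _ openT (sf_smooth f)).
apply: smooth_on_sum => // i; apply: smooth_onM => //.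
- exact: (sec_smooth X (a : triv tangent_bundle)).
- exact: smooth_on_partial openT (sf_smooth f).
Qed.

Definition vector_field_act (X : smooth_section tangent_bundle)
  (f : smooth_fun M) : smooth_fun M := SmoothFun (vector_field_smooth X f).

End TangentBundle.

Section Subbundles.
Variables (R : realType) (n : nat) (M : smooth_manifold R n).
Variable E : vector_bundle M.

(* Local triviality of the pair (E, F): near every point, some local
   trivialization of [E] in its maximal atlas identifies [F] with the span of
   the first [r] vectors of the standard basis. *)
Definition adapted_frame (F : forall x, {vspace E x}) (r : nat)
    (U : set M) (e : forall x, (vb_rank E).-tuple (E x)) : Prop :=
  compatible_frame U e /\ forall x, U x -> F x = <<take r (e x)>>%VS.

Record subbundle := Subbundle {
  sb_fiber :> forall x, {vspace E x};
  sb_rank : nat;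
  sb_rank_le : (sb_rank <= vb_rank E)%N;
  sb_adapted : forall p, exists U e, U p /\ adapted_frame sb_fiber sb_rank U e
}.

Variable F : subbundle.

Definition sb_triv : Type :=
  {Ue : set M * (forall x, (vb_rank E).-tuple (E x)) |
    adapted_frame F (sb_rank F) Ue.1 Ue.2}.

Definition sb_triv_dom (t : sb_triv) : set M := (sval t).1.

Definition sb_frame (t : sb_triv) (x : M) : (sb_rank F).-tuple (subvs_of (F x)) :=
  sub_frame (sb_rank F) (F x) ((sval t).2 x).

Lemma sb_triv_dom_open t : open (sb_triv_dom t).
Proof. by case: t => -[U e] [[]]. Qed.

Lemma sb_triv_cover x : exists t, sb_triv_dom t x.
Proof. by have [U [e [Ux He]]] := sb_adapted F x; exists (exist _ (U, e) He). Qed.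

Lemma sb_frame_basis t x : sb_triv_dom t x -> basis_of fullv (sb_frame t x).
Proof.
case: t => -[U e] [[oU be se te] eF] Ux.
by apply: sub_frame_basis; [exact: sb_rank_le|exact: (be x Ux)|exact: (eF x Ux)].
Qed.

Lemma coord_sb_frame t x (Ux : sb_triv_dom t x) j (u : subvs_of (F x)) :
  coord (sb_frame t x) j u =
  coord ((sval t).2 x) (widen_ord (sb_rank_le F) j) (vsval u).
Proof.
case: t Ux => -[U e] [[oU be se te] eF] Ux.
by apply: coord_sub_frame; [exact: (be x Ux)|exact: (eF x Ux)].
Qed.

Lemma sb_frameE t x i : sb_triv_dom t x -> (i < sb_rank F)%N ->
  vsval (sb_frame t x)`_i = ((sval t).2 x)`_i.
Proof.
case: t => -[U e] [[oU be se te] eF] Ux ir.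
exact: (sub_frameE (sb_rank_le F) (eF x Ux) (Ordinal ir)).
Qed.

Lemma sb_frame_smooth t (i : 'I_(sb_rank F)) :
  smooth_section_on (sb_triv_dom t) (fun x => vsval (sb_frame t x)`_i).
Proof.
move=> u j; have oW : open (sb_triv_dom t `&` triv_dom u).
  by apply: openI; [exact: sb_triv_dom_open|exact: triv_dom_open].
have [[_ _ se _] _] := svalP t.
apply: (smooth_on_ext oW _ (se (widen_ord (sb_rank_le F) i) u j)).
by move=> x [tx _]; rewrite sb_frameE.
Qed.

Lemma sb_coord_smooth t W (s : forall x, subvs_of (F x)) j :
  open W -> smooth_section_on W (fun x => vsval (s x)) ->
  smooth_on (W `&` sb_triv_dom t) (fun x => coord (sb_frame t x) j (s x)).
Proof.
move=> oW ss; have oV : open (W `&` sb_triv_dom t) by apply: openI => //; exact: sb_triv_dom_open.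
have [ce _] := svalP t.
apply: (smooth_on_ext oV _ (smooth_coord_frame (widen_ord (sb_rank_le F) j) oW ce ss)).
by move=> x [_ tx]; rewrite coord_sb_frame.
Qed.

Lemma sb_frame_transition t u (i j : 'I_(sb_rank F)) :
  smooth_on (sb_triv_dom t `&` sb_triv_dom u)
    (fun x => coord (sb_frame u x) j (sb_frame t x)`_i).
Proof.
apply: sb_coord_smooth; first exact: sb_triv_dom_open.
exact: sb_frame_smooth.
Qed.

Definition subbundle_bundle : vector_bundle M := {|
  vb_fiber := fun x => subvs_of (F x);
  triv_dom_open := sb_triv_dom_open;
  triv_cover := sb_triv_cover;
  frame_basis := sb_frame_basis;
  frame_transition := sb_frame_transition
|}.

Lemma sb_incl_smooth (t : triv subbundle_bundle) (i : 'I_(sb_rank F)) :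
  smooth_section_on (triv_dom t)
    (fun x => (linfun (vsval : subvs_of (F x) -> E x)) (frame t x)`_i).
Proof.
have := @sb_frame_smooth t i; congr smooth_section_on.
by apply: functional_extensionality_dep => x; rewrite lfunE.
Qed.

Definition sb_incl : bundle_map subbundle_bundle E := BundleMap sb_incl_smooth.

Definition section_in (s : smooth_section E) : Prop := forall x, s x \in F x.

Lemma sb_restrict_smooth (s : smooth_section E) (sF : section_in s) :
  @smooth_section_on _ _ _ subbundle_bundle setT (fun x => vsproj (F x) (s x)).
Proof.
move=> t j; apply: sb_coord_smooth; first exact: openT.
have := sec_smooth s; congr smooth_section_on.
by apply: functional_extensionality_dep => x; rewrite vsprojK.
Qed.

(* A section of [E] with values in [F], seen as a section of [F]. *)
Definition sb_restrict (s : smooth_section E) (sF : section_in s) :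
  smooth_section subbundle_bundle := SmoothSection (sb_restrict_smooth sF).

Lemma sb_incl_in (s : smooth_section subbundle_bundle) :
  section_in (bm_section sb_incl s).
Proof. by move=> x /=; rewrite lfunE; exact: subvsP. Qed.

End Subbundles.

Section SkewForms.
Variables (R : realType) (n : nat) (M : smooth_manifold R n).

Record skew_form (E : vector_bundle M) := SkewForm {
  form :> forall x, E x -> E x -> R;
  form_linear_l : forall x c (u v w : E x),
    form (c *: u + v) w = c * form u w + form v w;
  form_linear_r : forall x c (u v w : E x),
    form w (c *: u + v) = c * form w u + form w v;
  form_skew : forall x (u v : E x), form u v = - form v u;
  form_nondegenerate : forall x (u : E x), (forall v, form u v = 0) -> u = 0;
  form_smooth : forall (t : triv E) (i j : 'I_(vb_rank E)),
    smooth_on (triv_dom t) (fun x => form (frame t x)`_i (frame t x)`_j)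
}.

Variables (E : vector_bundle M) (w : skew_form E).

Lemma form_suml x m (c : 'I_m -> R) (u : 'I_m -> E x) v :
  w x (\sum_i c i *: u i) v = \sum_i c i * w x (u i) v.
Proof.
have w0 : w x 0 v = 0.
  have := form_linear_l w 1 (0 : E x) 0 v.
  by rewrite scaler0 addr0 mul1r => /(congr1 (fun z => z - w x 0 v)); rewrite addrK subrr.
elim: (index_enum _) => [|i s IH]; first by rewrite !big_nil.
by rewrite !big_cons form_linear_l IH.
Qed.

Lemma form_sumr x m (c : 'I_m -> R) (u : 'I_m -> E x) v :
  w x v (\sum_i c i *: u i) = \sum_i c i * w x v (u i).
Proof.
rewrite form_skew form_suml -sumrN; apply: eq_bigr => i _.
by rewrite form_skew mulrN opprK.
Qed.

Lemma form_section_smooth (s t : smooth_section E) :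
  smooth_on setT (fun x => w x (s x) (t x)).
Proof.
apply: smooth_on_local => p _; have [u up] := triv_cover E p.
have oV : open (setT `&` triv_dom u) by apply: openI; [exact: openT|exact: triv_dom_open].
exists (setT `&` triv_dom u); split=> //.
apply: (smooth_on_ext oV (f := fun x => \sum_i coord (frame u x) i (s x) *
  \sum_j coord (frame u x) j (t x) * w x (frame u x)`_i (frame u x)`_j)).
  move=> x [_ ux]; rewrite [in RHS](coord_basis (frame_basis ux) (memvf (s x))).
  rewrite form_suml; apply: eq_bigr => i _; congr (_ * _).
  by rewrite -form_sumr -(coord_basis (frame_basis ux) (memvf (t x))).
apply: smooth_on_sum => // i; apply: smooth_onM => //; first exact: sec_smooth.
apply: smooth_on_sum => // j; apply: smooth_onM => //; first exact: sec_smooth.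
by apply: smooth_on_sub (@form_smooth _ w u i j) => x [].
Qed.

Definition form_section (s t : smooth_section E) : smooth_fun M :=
  SmoothFun (form_section_smooth s t).

End SkewForms.

Section Algebroids.
Variables (R : realType) (n : nat) (M : smooth_manifold R n).

Definition section_product (E : vector_bundle M) :=
  smooth_section E -> smooth_section E -> smooth_section E.

Definition real_bilinear (E : vector_bundle M) (mul : section_product E) : Prop :=
  (forall (c : R) s t u,
     mul (sf_cst M c *: s + t) u = sf_cst M c *: mul s u + mul t u) /\
  (forall (c : R) s t u,
     mul u (sf_cst M c *: s + t) = sf_cst M c *: mul u s + mul u t).

Definition associator (E : vector_bundle M) (mul : section_product E) s t u :=
  mul s (mul t u) - mul (mul s t) u.

Definition sec_commutator (E : vector_bundle M) (mul : section_product E) s t :=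
  mul s t - mul t s.

Definition anchor_act (E : vector_bundle M)
    (rho : bundle_map E (tangent_bundle M)) (s : smooth_section E)
    (f : smooth_fun M) : smooth_fun M :=
  vector_field_act (bm_section rho s) f.

Definition form_T (E : vector_bundle M) (w : skew_form E) (mul : section_product E)
    (e1 e2 e3 : smooth_section E) : smooth_fun M :=
  form_section w (mul e1 e2) e3 + form_section w e1 (mul e2 e3)
  - form_section w (mul e2 e1) e3 - form_section w e2 (mul e1 e3).

(* The operator [psa_D] is uniquely determined by [psa_DE], since the form is
   nondegenerate. *)
Record pre_symplectic_algebroid := PreSymplecticAlgebroid {
  psa_bundle :> vector_bundle M;
  psa_form : skew_form psa_bundle;
  psa_mul : section_product psa_bundle;
  psa_anchor : bundle_map psa_bundle (tangent_bundle M);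
  psa_D : smooth_fun M -> smooth_section psa_bundle;
  psa_mul_bilinear : real_bilinear psa_mul;
  psa_DE : forall f e,
    form_section psa_form (psa_D f) e = anchor_act psa_anchor e f;
  psa_associator : forall e1 e2 e3,
    associator psa_mul e1 e2 e3 - associator psa_mul e2 e1 e3 =
    sf_cst M 6^-1 *: psa_D (form_T psa_form psa_mul e1 e2 e3);
  psa_invariance : forall e1 e2 e3,
    anchor_act psa_anchor e1 (form_section psa_form e2 e3) =
    form_section psa_form
      (psa_mul e1 e2 - sf_cst M 2^-1 *: psa_D (form_section psa_form e1 e2)) e3
    + form_section psa_form e2 (sec_commutator psa_mul e1 e3)
}.

Record left_symmetric_algebroid (A : vector_bundle M) (mul : section_product A)
    (a : bundle_map A (tangent_bundle M)) : Prop := LeftSymmetricAlgebroid {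
  lsa_bilinear : real_bilinear mul;
  lsa_left_symmetric : forall x y z, associator mul x y z = associator mul y x z;
  lsa_leibniz : forall x (f : smooth_fun M) y,
    mul x (f *: y) = f *: mul x y + anchor_act a x f *: y;
  lsa_left_linear : forall (f : smooth_fun M) x y, mul (f *: x) y = f *: mul x y
}.

Definition isotropic (E : vector_bundle M) (w : skew_form E) (x : M)
    (V : {vspace E x}) : Prop :=
  forall u v, u \in V -> v \in V -> w x u v = 0.

Record dirac_structure (P : pre_symplectic_algebroid) := DiracStructure {
  dirac_subbundle :> subbundle P;
  dirac_isotropic : forall x, isotropic (psa_form P) (dirac_subbundle x);
  dirac_maximal : forall x (V : {vspace P x}), isotropic (psa_form P) V ->
    (dirac_subbundle x <= V)%VS -> V = dirac_subbundle x;
  dirac_integrable : forall s t, section_in dirac_subbundle s ->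
    section_in dirac_subbundle t -> section_in dirac_subbundle (psa_mul s t)
}.

Variables (P : pre_symplectic_algebroid) (F : dirac_structure P).

Definition dirac_mul : section_product (subbundle_bundle F) := fun s t =>
  sb_restrict (dirac_integrable (sb_incl_in s) (sb_incl_in t)).

Definition dirac_anchor : bundle_map (subbundle_bundle F) (tangent_bundle M) :=
  bm_comp (psa_anchor P) (sb_incl F).

End Algebroids.

Arguments dirac_mul {R n M P} F s t.
Arguments dirac_anchor {R n M P} F.

(* Main.v *)
Require Import Defs.
From mathcomp Require Import all_boot all_order all_algebra.
From mathcomp Require Import boolp classical_sets functions reals topology.
From mathcomp Require Import normedtype derive sequences realfun exp.
From mathcomp Require Import ring.

(** The axioms of a pre-symplectic algebroid differ from those of a
left-symmetric algebroid by terms in the operator D: the associator fails to be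
symmetric by D T(x, y, z) / 6, and the invariance of the form contains
D (e1, e2) / 2.  On sections of an isotropic subbundle closed under the product,
T(x, y, z) and (e1, e2) are both zero, so everything follows once D 0 = 0.

The two compatibility rules with multiplication by a function f come from the
invariance axiom.  When (x, y) = 0 it reads, for every section e of E,
(x * y, e) = rho(x)(y, e) - (y, [x, e])  ([isotropic_pairing]).  Replacing y by
f y, the Leibniz rule of the vector field rho(x) gives
x * (f y) = f (x * y) + rho(x)(f) y.  Replacing x by f x, one needs the bracket
of f x with e; substituting f e3 for e3 in the invariance axiom shows that the
bracket satisfies the Leibniz rule when it is paired with any section
([bracket_leibniz]), and the term where e differentiates f carries the factor
(y, x) = 0, so (f x) * y = f (x * y).

All these identities, and D 0 = 0 itself, are obtained after pairing with an
arbitrary global section.  The form is nondegenerate in each fibre, so they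
imply equality of sections as soon as every vector of E is the value of a global
section ([section_through]).  This is the only analytic point: it needs a smooth
function on M that does not vanish at a given point and has closed support in a
given neighbourhood ([exists_bump]).  In a chart that function is
exp(-1 / (r^2 - |y - y0|^2)), extended by 0; it is supported in the image of a
compact box, which is closed because M is Hausdorff. *)

Set Implicit Arguments.
Unset Strict Implicit.
Unset Printing Implicit Defensive.

Import Order.TTheory GRing.Theory Num.Theory.
Import numFieldNormedType.Exports.

Local Open Scope classical_set_scope.
Local Open Scope ring_scope.

(** * Flat functions *)

Section Flat.
Variable R : realType.

(** The exponent [m] is there because the functions t^(-m) exp(-1/t) form a
family whose span is closed under differentiation, whereas exp(-1/t) alone is
not: smoothness then follows by one induction over the whole family. *)
Definition flat (m : nat) (t : R) : R :=
  if 0 < t then t^-1 ^+ m * expR (- t^-1) else 0.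

Lemma flat_le0 m t : t <= 0 -> flat m t = 0.
Proof. by rewrite /flat ltNge => ->. Qed.

Lemma flat_gt0 t : 0 < t -> 0 < flat 0 t.
Proof. by rewrite /flat => ->; rewrite expr0 mul1r expR_gt0. Qed.

Lemma flatS m t : flat m t = t * flat m.+1 t.
Proof.
rewrite /flat; case: ifPn => [t0|]; last by rewrite mulr0.
by rewrite exprS -!mulrA mulVKf ?gt_eqF.
Qed.

(** The exponential of 1/t dominates (1/t)^(m+1) / (m+1)!, by its power series. *)
Lemma flat_bound m t : `|flat m t| <= (m.+1)`!%:R * `|t|.
Proof.
rewrite /flat; case: ifPn => [t0|_]; last by rewrite normr0 mulr_ge0.
have u0 : 0 < t^-1 by rewrite invr_gt0.
rewrite !gtr0_norm ?mulr_gt0 ?exprn_gt0 ?expR_gt0 //.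
rewrite expRN ler_pdivrMr ?expR_gt0 //.
have H : t^-1 ^+ m.+1 / (m.+1)`!%:R <= expR t^-1.
  by apply: le_trans (expR_ge1Dxn m (ltW u0)); rewrite lerDr.
rewrite ler_pdivrMr ?ltr0n ?fact_gt0 // in H.
by rewrite mulrAC -ler_pdivrMr // -exprSr [X in _ <= X]mulrC.
Qed.

Lemma flat_cvg0 m : flat m h @[h --> (0 : R)] --> (0 : R).
Proof.
apply/norm_cvg0P.
have bound0 : (m.+1)`!%:R * `|t| @[t --> (0 : R)] --> (0 : R).
  rewrite -[X in _ --> X](mulr0 (m.+1)`!%:R); apply: cvgMr.
  by rewrite -[X in _ --> X](@normr0 _ R); apply: cvg_norm; exact: cvg_id.
apply: (squeeze_cvgr _ (cvg_cst 0) bound0).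
by near=> t; rewrite normr_ge0 flat_bound.
Unshelve. all: by end_near. Qed.

(** At the origin the difference quotient of [flat m] is [flat m.+1], by [flatS],
and therefore tends to 0; elsewhere the rule is ordinary calculus. *)
Lemma is_derive_flat (m : nat) (t : R) :
  is_derive t 1 (flat m) (flat m.+2 t - m%:R * flat m.+1 t).
Proof.
have [t0|t0|->] := ltgtP t 0.
- rewrite !(flat_le0 _ (ltW t0)) mulr0 subr0.
  apply: (@near_eq_is_derive _ _ _ (cst 0)).
  by near=> x; rewrite /flat ltNge ltW //; near: x; exact: lt_nbhsl.
- have tn0 : t != 0 by rewrite gt_eqF.
  pose g : R -> R := (fun x : R => x^-1) ^+ m * (expR \o (fun x : R => - x^-1)).
  apply: (@near_eq_is_derive _ _ _ g).
    by near=> x; rewrite /flat ifT; [rewrite /g exprfctE|near: x; exact: lt_nbhsr].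
  have dV : is_derive t 1 (fun x : R => x^-1) (- t ^- 2).
    by apply: is_derive_eq (is_deriveV tn0 (is_derive_id _ _)) _; rewrite scaler1.
  have dN : is_derive t 1 (fun x : R => - x^-1) (t ^- 2).
    by rewrite -[t ^- 2]opprK; exact: is_deriveN dV.
  have dE : is_derive t 1 (expR \o (fun x : R => - x^-1)) _ :=
    @is_derive1_comp _ expR (fun x : R => - x^-1) t _ _ (is_derive_expR (- t^-1)) dN.
  apply: is_derive_eq (is_deriveM (is_deriveX m dV) dE) _.
  rewrite /flat t0 /= /GRing.scale /= exprfctE.
  rewrite -!exprVn; set u := t^-1; set E := expR _.
  by case: m {g} => [|m]; rewrite /= ?exprS; ring.
- rewrite !(flat_le0 _ (lexx 0)) mulr0 subr0.
  have dq : h^-1 *: (flat m (h *: 1 + 0) - flat m 0) @[h --> (0 : R)^'] --> (0 : R).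
    have fl0 : flat m.+1 h @[h --> (0 : R)^'] --> (0 : R).
      by apply: cvg_trans (@flat_cvg0 m.+1); apply: cvg_app; exact: cvg_within.
    apply: cvg_trans fl0; apply: near_eq_cvg; near=> h.
    have h0 : h != 0 by near: h; exact: nbhs_dnbhs_neq.
    rewrite (flat_le0 _ (lexx 0)) subr0 addr0 [h *: 1]mulr1.
    by rewrite [flat m h]flatS /GRing.scale /= mulKf.
  split; first by apply/cvg_ex; exists 0.
  exact: cvg_lim.
Unshelve. all: by end_near. Qed.
End Flat.

(** By the chain rule a partial derivative of [flat m \o g] is a combination of
[flat m.+2 \o g] and [flat m.+1 \o g] times a partial derivative of [g], hence
the induction on [k] with [m] generalized. *)
Lemma Ck_flat (R : realType) n k (A : set 'rV[R]_n) m (g : 'rV[R]_n -> R) :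
  open A -> Ck k A g -> Ck k A (fun y => flat m (g y)).
Proof.
move=> oA.
have df m' t : differentiable (@flat R m') t.
  by apply/derivable1_diffP; have [] := is_derive_flat m' t.
elim: k m g => [|k IH] m g.
  move=> cg y Ay; apply: (@continuous_comp _ _ _ g (flat m)); first exact: cg.
  exact: differentiable_continuous.
move=> Sg; move: (Sg) => [dg pg]; split=> [y Ay|i].
  by apply: (@differentiable_comp _ _ _ _ g (flat m)) => //; exact: dg.
pose dflat y := flat m.+2 (g y) + (- m%:R) * flat m.+1 (g y).
apply: (Ck_ext oA (f := fun y => dflat y * partial i g y)).
  move=> y Ay; rewrite /partial.
  rewrite [RHS]deriveE; last by apply: differentiable_comp => //; exact: dg.
  rewrite diff_comp //; last exact: dg.
  rewrite /= diff1E // derive1E -deriveE; last exact: dg.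
  have /@derive_val -> := is_derive_flat m (g y).
  by rewrite /dflat mulNr mulrC.
apply: CkM => //; last exact: pg.
apply: (CkD (f := fun y => flat m.+2 (g y))) => //.
  exact: IH (CkW Sg).
by apply: (CkM (f := fun=> - m%:R)) => //; [exact: Ck_cst|exact: IH (CkW Sg)].
Qed.

(** * Bump functions and global sections *)

Section Bump.
Variables (R : realType) (n : nat) (M : smooth_manifold R n).

Definition bump_profile (y0 : 'rV[R]_n) (r : R) (y : 'rV[R]_n) : R :=
  flat 0 (r ^+ 2 - \sum_j (y 0 j - y0 0 j) ^+ 2).

Lemma Coo_bump_profile A y0 r : open A -> Coo A (bump_profile y0 r).
Proof.
move=> oA k; apply: Ck_flat => //.
apply: (CkD (f := fun=> r ^+ 2)) => //; first exact: Ck_cst.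
have -> : (fun y : 'rV[R]_n => - \sum_j (y 0 j - y0 0 j) ^+ 2) =
    fun y => \sum_j ((-1) * ((y 0 j + - y0 0 j) * (y 0 j + - y0 0 j))).
  apply: funext => y; rewrite -sumrN; apply: eq_bigr => j _.
  by rewrite mulN1r expr2.
apply: Ck_sum => // j; apply: (CkM (f := fun=> -1)) => //; first exact: Ck_cst.
have Cd : Ck k A (fun y => y 0 j + - y0 0 j).
  by apply: CkD => //; [exact: Ck_coord|exact: Ck_cst].
exact: CkM.
Qed.

Lemma bump_profile_center y0 r : 0 < r -> bump_profile y0 r y0 != 0.
Proof.
move=> r0; rewrite gt_eqF // flat_gt0 // big1 ?subr0 ?exprn_gt0 // => j _.
by rewrite subrr expr0n.
Qed.

Lemma bump_profile_support y0 r y : 0 <= r -> bump_profile y0 r y != 0 ->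
  forall j, y0 0 j - r <= y 0 j <= y0 0 j + r.
Proof.
move=> r0 + j; apply: contraR => yj; apply/eqP/flat_le0.
rewrite subr_le0 (bigD1 j) //= -[leLHS]addr0 lerD //; last first.
  by apply: sumr_ge0 => i _; exact: sqr_ge0.
rewrite -ler_distl in yj.
by rewrite -[leRHS]real_normK ?num_real // ler_pXn2r ?nnegrE // ltW // ltNge.
Qed.

(** Outside the chart domain [chart_to] is meaningless, so the function has to be
cut off there.  The result is smooth because M is covered by the chart domain,
where it is the smooth profile, and by the complement of the compact set [K],
where it is zero. *)
Lemma exists_bump (U : set M) (p : M) : open U -> U p ->
  exists (f : smooth_fun M) (K : set M),
    [/\ f p != 0, closed K, K `<=` U & forall x, ~ K x -> f x = 0].
Proof.
move=> oU Up; pose a := chart_at p; have ap : chart_dom a p := chart_at_dom p.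
pose y0 := chart_to a p.
have /nbhs_ballP[e /= e0 eU] : nbhs y0 (chart_image a U).
  apply: open_nbhs_nbhs; split; first exact: chart_image_open.
  by split; [exact: chart_to_cod|rewrite /= chart_toK].
pose r := e / 2; have r0 : 0 < r by rewrite divr_gt0.
pose I j : set R := `[y0 0 j - r, y0 0 j + r]%classic.
pose B := [set y : 'rV[R]_n | forall j, I j (y 0 j)].
have cB : compact B by apply: rV_compact => j; exact: segment_compact.
have BU : B `<=` chart_image a U.
  move=> y By; apply: eU; split=> // i j; rewrite (ord1 i) /ball /= distrC.
  have := By j; rewrite /I /= in_itv /= -ler_distl => /le_lt_trans; apply.
  by rewrite /r ltr_pdivrMr // ltr_pMr // ltr1n.
pose K := chart_of a @` B.
have cK : closed K.
  apply: compact_closed; first exact: mf_hausdorff.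
  apply: continuous_compact => //; apply: continuous_in_subspaceT => y.
  by rewrite inE => /BU[ay _]; exact: chart_of_continuous.
have KU : K `<=` U by move=> _ [y /BU[_ Uy] <-].
have Ka : K `<=` chart_dom a by move=> _ [y /BU[ay _] <-]; exact: chart_of_dom.
pose f x := if `[< chart_dom a x >] then bump_profile y0 r (chart_to a x) else 0.
have fK x : ~ K x -> f x = 0.
  rewrite /f; case: asboolP => // ax; apply: contra_notP => /eqP fx.
  exists (chart_to a x); last exact: chart_toK.
  by move=> j; rewrite /I /= in_itv /=; exact: bump_profile_support (ltW r0) fx j.
have sf : smooth_on setT f.
  apply: smooth_on_local => x _; have [Kx|nKx] := pselect (K x).
    exists (chart_dom a); split; [exact: chart_dom_open|exact: Ka|].
    apply: smooth_on_chart => z az; exists a, (chart_dom a); split=> //.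
      exact: chart_dom_open.
    have oI : open (chart_image a (chart_dom a)) by apply/chart_image_open/chart_dom_open.
    move=> k; apply: (Ck_ext oI _ (Coo_bump_profile y0 r oI k)).
    by move=> y [ay /= ay']; rewrite /f asboolT // chart_ofK.
  have oK : open (~` K) by exact: closed_openC.
  exists (~` K); split=> //; apply: (smooth_on_ext oK _ (smooth_on_cst _ 0)) => z.
  by move=> /fK ->.
exists (SmoothFun sf), K; split=> //.
by rewrite /= /f asboolT // bump_profile_center.
Qed.

(** A section with constant coefficients in a local frame, multiplied by a bump
function; dividing the coefficients by [f p] compensates for its value at [p]. *)
Lemma section_through (E : vector_bundle M) (p : M) (v : E p) :
  exists s : smooth_section E, s p = v.
Proof.
have [t tp] := triv_cover E p.
have [f [K [fp cK Kt fK]]] := exists_bump (triv_dom_open t) tp.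
pose c i := (f p)^-1 * coord (frame t p) i v.
pose s x : E x := \sum_i (f x * c i) *: (frame t x)`_i.
have ss : smooth_section_on setT s.
  apply: smooth_section_local => x _; have [Kx|nKx] := pselect (K x).
    have ot := triv_dom_open t; exists (triv_dom t); split=> //; first exact: Kt.
    apply: (smooth_section_frame ot (frame_compatible t)) => // j.
    apply: (smooth_on_ext ot (f := fun x => f x * c j)).
      by move=> z tz; rewrite coord_sum_free // (basis_free (frame_basis tz)).
    apply: smooth_onM => //; last exact: smooth_on_cst.
    by apply: smooth_on_sub (sf_smooth f).
  exists (~` K); split; [exact: closed_openC|by []|].
  move=> u j; apply: (smooth_on_ext _ _ (smooth_on_cst _ 0)).
    by apply: openI; [exact: closed_openC|exact: triv_dom_open].
  move=> z [/fK fz _]; rewrite /s big1 ?linear0 // => i _.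
  by rewrite fz mul0r scale0r.
exists (SmoothSection ss).
rewrite /= /s [RHS](coord_basis (frame_basis tp) (memvf v)).
by apply: eq_bigr => i _; rewrite mulVKf.
Qed.

End Bump.

(** * The form on sections *)

Section FormSections.
Variables (R : realType) (n : nat) (M : smooth_manifold R n).
Variables (E : vector_bundle M) (w : skew_form E).
Implicit Types (s t u : smooth_section E) (f : smooth_fun M).

(** Fibrewise nondegeneracy passes to sections because each vector of the fibre
is reached by a global section. *)
Lemma form_section_inj s t :
  (forall e, form_section w s e = form_section w t e) -> s = t.
Proof.
move=> st; apply: smooth_sectionP => x; apply/eqP; rewrite -subr_eq0.
apply/eqP; apply: (form_nondegenerate (s := w)) => v.
have [e <-] := section_through v.
have /(congr1 (fun g : smooth_fun M => g x)) /= stx := st e.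
rewrite addrC -scaleN1r form_linear_l stx; ring.
Qed.

Lemma form_sectionC s t : form_section w s t = - form_section w t s.
Proof. by apply: smooth_funP => x /=; rewrite form_skew mulN1r. Qed.

Lemma form_sectionDl s t u :
  form_section w (s + t) u = form_section w s u + form_section w t u.
Proof.
by apply: smooth_funP => x /=; rewrite -[s x]scale1r form_linear_l mul1r scale1r.
Qed.

Lemma form_sectionZl f s u : form_section w (f *: s) u = f * form_section w s u.
Proof.
apply: smooth_funP => x /=; have := form_linear_l w (f x) (s x) 0 (u x).
have -> : w x 0 (u x) = 0.
  by have := form_suml w (fun=> 0) (fun=> 0) (u x) (m := 0); rewrite !big_ord0.
by rewrite !addr0.
Qed.

Lemma form_sectionNl s u : form_section w (- s) u = - form_section w s u.
Proof. by rewrite -scaleN1r form_sectionZl mulN1r. Qed.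

Lemma form_sectionZr f s u : form_section w u (f *: s) = f * form_section w u s.
Proof. by rewrite !(form_sectionC u) form_sectionZl mulrN. Qed.

Lemma form_sectionNr s u : form_section w u (- s) = - form_section w u s.
Proof. by rewrite !(form_sectionC u) form_sectionNl. Qed.

End FormSections.

(** * The action of sections on functions *)

Section AnchorAct.
Variables (R : realType) (n : nat) (M : smooth_manifold R n).
Variables (E : vector_bundle M) (rho : bundle_map E (tangent_bundle M)).
Implicit Types (s t u : smooth_section E) (f g : smooth_fun M).

Lemma differentiable_chart_at f x :
  differentiable (f \o chart_of (chart_at x)) (chart_to (chart_at x) x).
Proof. exact: smooth_on_differentiable (sf_smooth f) _ (chart_at_dom x). Qed.

Lemma anchor_act0 s : anchor_act rho s 0 = 0.
Proof. by apply: smooth_funP => x; rewrite /= /tangent_deriv derive_cst. Qed.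

Lemma anchor_actM s f g :
  anchor_act rho s (f * g) = anchor_act rho s f * g + f * anchor_act rho s g.
Proof.
apply: smooth_funP => x; rewrite /= /tangent_deriv.
have df := diff_derivable (differentiable_chart_at f x).
have dg := diff_derivable (differentiable_chart_at g x).
rewrite [LHS](deriveM (df _) (dg _)) /= chart_toK; last exact: chart_at_dom.
by rewrite /GRing.scale /= addrC [X in X + _]mulrC.
Qed.

Lemma anchor_actZ f s g : anchor_act rho (f *: s) g = f * anchor_act rho s g.
Proof.
apply: smooth_funP => x; rewrite /= /tangent_deriv.
by rewrite !deriveE ?linearZ //; exact: differentiable_chart_at.
Qed.

End AnchorAct.

(** * Consequences of the invariance axiom *)

Section PreSymplectic.
Variables (R : realType) (n : nat) (M : smooth_manifold R n).
Variable E : pre_symplectic_algebroid M.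
Local Notation "s ⋆ t" := (psa_mul s t) (at level 40).
Local Notation "⟨ s , t ⟩" := (form_section (psa_form E) s t).
Local Notation br := (sec_commutator (@psa_mul _ _ _ E)).
Local Notation act := (anchor_act (psa_anchor E)).

(** Additivity of D is not among the axioms, but D f is determined by its
pairings, and (D 0, e) is the derivative of a constant. *)
Lemma psa_D0 : psa_D E 0 = 0.
Proof.
apply: (form_section_inj (w := psa_form E)) => e.
by rewrite psa_DE anchor_act0 -[0 in RHS](scale0r 0) form_sectionZl mul0r.
Qed.

(** Only the third argument of the invariance axiom is rescaled, and there the
term with D and the product enter function-linearly; what is left over from the
derivation on the left-hand side must come from the bracket. *)
Lemma bracket_leibniz s t f u :
  ⟨u, br s (f *: t)⟩ = f * ⟨u, br s t⟩ + act s f * ⟨u, t⟩.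
Proof.
have := psa_invariance s u (f *: t); rewrite !form_sectionZr anchor_actM.
by rewrite (psa_invariance s u t) mulrDr addrCA => /addrI <-; rewrite addrC.
Qed.

Lemma isotropic_pairing s t u : ⟨s, t⟩ = 0 ->
  ⟨s ⋆ t, u⟩ = act s ⟨t, u⟩ - ⟨t, br s u⟩.
Proof.
by move=> st; rewrite psa_invariance st psa_D0 scaler0 subr0 addrK.
Qed.

(** The bracket in [isotropic_pairing] does not involve [t], so replacing [t] by
[f *: t] only makes the vector field of [s] differentiate [f]. *)
Lemma isotropic_leibniz s t f : ⟨s, t⟩ = 0 ->
  s ⋆ (f *: t) = f *: (s ⋆ t) + act s f *: t.
Proof.
move=> st; apply: (form_section_inj (w := psa_form E)) => u.
rewrite isotropic_pairing ?form_sectionZr ?st ?mulr0 //.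
rewrite form_sectionDl !form_sectionZl isotropic_pairing // anchor_actM; ring.
Qed.

(** Here [f] appears inside a bracket; the extra term that the Leibniz rule
produces is a multiple of the pairing of [t] with [s]. *)
Lemma isotropic_left_linear s t f : ⟨s, t⟩ = 0 ->
  (f *: s) ⋆ t = f *: (s ⋆ t).
Proof.
move=> st; apply: (form_section_inj (w := psa_form E)) => u.
rewrite isotropic_pairing ?form_sectionZl ?st ?mulr0 //.
rewrite isotropic_pairing // anchor_actZ.
have brC v : ⟨t, br v u⟩ = - ⟨t, br u v⟩.
  by rewrite -form_sectionNr opprB.
rewrite !brC bracket_leibniz (form_sectionC _ t s) st; ring.
Qed.

End PreSymplectic.

(** * Sections of a Dirac structure *)

Section DiracSections.
Variables (R : realType) (n : nat) (M : smooth_manifold R n).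
Variables (E : pre_symplectic_algebroid M) (F : dirac_structure E).
Local Notation incl := (bm_section (sb_incl F)).
Implicit Types s t u : smooth_section (subbundle_bundle F).

Lemma incl_inj : injective incl.
Proof.
move=> s t st; apply: smooth_sectionP => x.
have /(congr1 (fun e : smooth_section E => e x)) /= := st.
by rewrite !lfunE; exact: val_inj.
Qed.

Lemma inclD s t : incl (s + t) = incl s + incl t.
Proof. by apply: smooth_sectionP => x /=; rewrite linearD. Qed.

Lemma inclZ f s : incl (f *: s) = f *: incl s.
Proof. by apply: smooth_sectionP => x /=; rewrite linearZ. Qed.

Lemma inclB s t : incl (s - t) = incl s - incl t.
Proof. by rewrite inclD -[- t]scaleN1r inclZ scaleN1r. Qed.

(** Projecting the product back to the subbundle loses nothing, by
integrability. *)
Lemma incl_dirac_mul s t : incl (dirac_mul F s t) = psa_mul (incl s) (incl t).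
Proof.
apply: smooth_sectionP => x /=; rewrite lfunE /= vsprojK //.
exact: (dirac_integrable (sb_incl_in s) (sb_incl_in t)).
Qed.

Lemma dirac_anchor_act s f :
  anchor_act (dirac_anchor F) s f = anchor_act (psa_anchor E) (incl s) f.
Proof. by apply: smooth_funP => x /=; rewrite comp_lfunE. Qed.

Lemma incl_isotropic s t : form_section (psa_form E) (incl s) (incl t) = 0.
Proof.
by apply: smooth_funP => x; apply: dirac_isotropic; exact: sb_incl_in.
Qed.

End DiracSections.

(** * Left symmetry and compatibility with functions *)

Theorem proposition3p16 (R : realType) (n : nat) (M : smooth_manifold R n)
    (E : pre_symplectic_algebroid M) (F : dirac_structure E) :
  left_symmetric_algebroid (dirac_mul F) (dirac_anchor F).
Proof.
split.
- have [bl br] := psa_mul_bilinear E.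
  split=> c s t u; apply: incl_inj;
    by rewrite !(incl_dirac_mul, inclD, inclZ) ?bl ?br.
- move=> x y z; apply: incl_inj; apply/eqP; rewrite -subr_eq0.
  rewrite !inclB !incl_dirac_mul; apply/eqP.
  have := psa_associator (bm_section (sb_incl F) x) (bm_section (sb_incl F) y)
    (bm_section (sb_incl F) z).
  (* each term of T pairs two sections of F, and T = 0 kills the right-hand side *)
  rewrite /form_T -!incl_dirac_mul !incl_isotropic !addr0 !subr0 psa_D0 scaler0 => <-.
  by rewrite /associator !incl_dirac_mul.
- move=> x f y; apply: incl_inj.
  rewrite incl_dirac_mul inclD !inclZ incl_dirac_mul dirac_anchor_act.
  exact: isotropic_leibniz (incl_isotropic x y).
- move=> f x y; apply: incl_inj; rewrite !(incl_dirac_mul, inclZ).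
  exact: isotropic_left_linear (incl_isotropic x y).
Qed.
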